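(* Let $r<w$ be positive reals. There is an optimal pure quantum online algorithm with a single advice qubit that uses a single qubit of memory for the $(n,k,r,w)$-Parity for Number of Hats problem.
   Context: A quantum online algorithm with advice (private qubits) computes its answer $y_i$ from a quantum message $|\phi\rangle$ sent by an Adviser who knows the whole input and from $x_1,\dots,x_i$; it may apply quantum operations and measure at any time; it is pure if it has no classical memory. It is $c$-competitive with advice complexity $b$ if there is $\alpha\ge0$ such that for every input $I$ there is $|\phi\rangle$ of at most $b$ qubits with $\mathbb{E}[cost]\le c\cdot cost(Opt(I))+\alpha$ ($Opt$ an optimal offline algorithm); optimal means $c=1$, $\alpha=0$. For $X\in\{0,1\}^m$ with $\#_1(X)=v\cdot 2^k$, $v$ an integer, $PartialMOD_m^k(X)=v\bmod 2$. The $(n,k,r,w)$-Parity for Number of Hats problem: feasible inputs are $I=(2,X_1,2,X_2,2,X_3)$ of length $n=m_1+m_2+m_3+3$, with $m_i\ge 2^{k+1}$, $X_i\in\{0,1\}^{m_i}$, $\#_1(X_i)$ a multiple of $2^k$. Let $y_1,y_2,y_3$ be the output bits at the three requests with value $2$ and $z_j=\bigoplus_{i=j}^{3}PartialMOD_{m_i}^k(X_i)$. The cost is $r$ if $y_j=z_j$ for all $j$, and $w$ otherwise, with $r<w$. *)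

(* Defs.v *)
From HB Require Import structures.
From mathcomp Require Import all_boot all_order all_algebra.
From mathcomp Require Import boolp reals.
From mathcomp.real_closed Require Import complex.

Set Implicit Arguments.
Unset Strict Implicit.
Unset Printing Implicit Defensive.

Import Order.TTheory GRing.Theory Num.Theory.
Local Open Scope ring_scope.

Record online_problem (R : realType) := OnlineProblem {
  request : Type;
  answer : Type;
  feasible : seq request -> Prop;
  cost : seq request -> seq answer -> R }.

Definition optimal_offline (R : realType) (P : online_problem R)
    (Opt : seq (request P) -> seq (answer P)) : Prop :=
  forall I, feasible I ->
    size (Opt I) = size I /\
    forall ys, size ys = size I -> cost I (Opt I) <= cost I ys.

(* Vectors of [s] qubits are columns indexed by the computational basis: qubit
   [j] of the basis state [i < 2 ^ s] is the binary digit of weight [2 ^ j]. *)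
Definition qvec (R : realType) (s : nat) := 'cV[R[i]]_(2 ^ s).

Definition qubit_value (j i : nat) : bool := odd (i %/ 2 ^ j).

Definition sqnorm (R : realType) (s : nat) (v : qvec R s) : R :=
  \sum_i Normc.normc (v i 0) ^+ 2.

(* Measurement of qubit [j] in the computational basis. The projection is not
   renormalized: [sqnorm] of a branch is the probability of reaching it. *)
Definition qproj (R : realType) (s : nat) (j : 'I_s) (o : bool)
    (v : qvec R s) : qvec R s :=
  \col_i (if qubit_value j i == o then v i 0 else 0).

(* A message of [b <= s] qubits held in the [b] low-weight qubits of an [s]-qubit
   memory, the other qubits being |0>. *)
Definition load (R : realType) (s b : nat) (phi : qvec R b) : qvec R s :=
  \col_i (if insub (val i) is Some j then phi j 0 else 0).

(* What may be done to [s] qubits between two requests: finitely many unitary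
   operations and measurements, in any order, later ones being allowed to depend
   on earlier outcomes. There are no ancillas besides the [s] qubits. *)
Inductive qprog (R : realType) (s : nat) (T : Type) : Type :=
| QRet of T
| QApply (U : 'M[R[i]]_(2 ^ s)) of U \is unitarymx & qprog R s T
| QMeasure of 'I_s & (bool -> qprog R s T).

Fixpoint qexec (R : realType) (s : nat) (T : Type) (q : qprog R s T)
    (v : qvec R s) : seq (T * qvec R s) :=
  match q with
  | QRet t => [:: (t, v)]
  | QApply U _ q' => qexec q' (U *m v)
  | QMeasure j f =>
      qexec (f false) (qproj j false v) ++ qexec (f true) (qproj j true v)
  end.

(* The classical memory has [cbits] bits, initially 0; the quantum memory has
   [qubits] qubits and initially holds the Adviser's message. Neither the
   requests already read nor the number of steps made is available otherwise. *)
Record quantum_online (R : realType) (X Y : Type) := QuantumOnline {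
  qubits : nat;
  cbits : nat;
  step : X -> cbits.-tuple bool -> qprog R qubits (cbits.-tuple bool * Y) }.

Definition pure (R : realType) (X Y : Type) (A : quantum_online R X Y) : Prop :=
  cbits A = 0%N.

(* All measurement branches of a run, each with its answers (one per request)
   and its unnormalized final state. *)
Fixpoint runs (R : realType) (X Y : Type) (A : quantum_online R X Y)
    (c : (cbits A).-tuple bool) (v : qvec R (qubits A)) (I : seq X) :
    seq (seq Y * qvec R (qubits A)) :=
  if I is x :: I' then
    flatten [seq [seq (br.1.2 :: e.1, e.2) | e <- runs br.1.1 br.2 I']
            | br <- qexec (step x c) v]
  else [:: ([::], v)].

Definition expected_cost (R : realType) (P : online_problem R)
    (A : quantum_online R (request P) (answer P))
    (v : qvec R (qubits A)) (I : seq (request P)) : R :=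
  \sum_(e <- runs [tuple of nseq (cbits A) false] v I)
    sqnorm e.2 * cost I e.1.

(* The advice occupies qubits of the memory, hence [b' <= qubits A]. *)
Definition competitive_within (R : realType) (P : online_problem R)
    (A : quantum_online R (request P) (answer P)) (c alpha : R) (b : nat) :
    Prop :=
  exists Opt : seq (request P) -> seq (answer P),
    optimal_offline Opt /\
    forall I, feasible I ->
      exists (b' : nat) (phi : qvec R b'),
        [/\ (b' <= b)%N, (b' <= qubits A)%N, sqnorm phi = 1 &
            expected_cost (load (qubits A) phi) I
              <= c * cost I (Opt I) + alpha].

Definition competitive (R : realType) (P : online_problem R)
    (A : quantum_online R (request P) (answer P)) (c : R) (b : nat) : Prop :=
  exists2 alpha : R, 0 <= alpha & competitive_within A c alpha b.

Definition optimal (R : realType) (P : online_problem R)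
    (A : quantum_online R (request P) (answer P)) (b : nat) : Prop :=
  competitive_within A 1 0 b.

Definition ones (X : seq bool) : nat := count_mem true X.

(* Meaningful only if [2 ^ k %| ones X]. *)
Definition partialMOD (k : nat) (X : seq bool) : bool :=
  odd (ones X %/ 2 ^ k).

Definition two : 'I_3 := inord 2.

Definition bit (b : bool) : 'I_3 := inord b.

(* Blocks are numbered from 0. *)
Definition hats_input (X : 3.-tuple (seq bool)) : seq 'I_3 :=
  flatten [seq two :: map bit Xi | Xi <- X].

Definition hats_feasible (n k : nat) (I : seq 'I_3) : Prop :=
  size I = n /\
  exists X : 3.-tuple (seq bool), I = hats_input X /\
    forall i, (2 ^ k.+1 <= size (tnth X i))%N /\ (2 ^ k %| ones (tnth X i))%N.

Definition hats_z (k : nat) (X : 3.-tuple (seq bool)) (j : 'I_3) : bool :=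
  \big[addb/false]_(i < 3 | (j <= i)%N) partialMOD k (tnth X i).

(* The answers at the requests of value 2. *)
Definition hat_answers (I : seq 'I_3) (ys : seq bool) : seq bool :=
  mask [seq x == two | x <- I] ys.

(* [hats_input] is injective, so the blocks of [I] are well defined. *)
Definition hats_correct (k : nat) (I : seq 'I_3) (ys : seq bool) : Prop :=
  exists X : 3.-tuple (seq bool),
    I = hats_input X /\ hat_answers I ys = [seq hats_z k X j | j <- enum 'I_3].

Definition hats (R : realType) (n k : nat) (r w : R) : online_problem R :=
  @OnlineProblem R 'I_3 bool (@hats_feasible n k)
    (fun I ys => if `[< hats_correct k I ys >] then r else w).

(* Main.v *)
(** The memory qubit is kept at a real state [cos a |0> + sin a |1>]. Each request
    1 rotates it by [pi / 2 ^ k.+1], so a block with [v * 2 ^ k] ones rotates it by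
    [v * pi / 2]: up to sign, this flips a basis state exactly when [v] is odd.
    If the Adviser sends the basis state of the first parity [z_0], then at the
    [j]-th request 2 the qubit is, up to sign, the basis state of [z_j]; measuring it
    gives [z_j] with certainty and leaves the state unchanged. *)
Require Import Defs.
From mathcomp Require Import all_boot all_order all_algebra.
From mathcomp Require Import reals.
From mathcomp Require Import boolp trigo ring.
From mathcomp.real_closed Require Import complex.
Import Order.TTheory GRing.Theory Num.Theory.
Local Open Scope ring_scope.
Local Open Scope complex_scope.

Definition rotation {R : realType} (a : R) : 'M[R[i]]_(2 ^ 1) :=
  \matrix_(i, j) (if i == j then cos a
                  else if val i == 0%N then - sin a else sin a)%:C.

Definition angle_state {R : realType} (a : R) : qvec R 1 :=
  \col_i (if val i == 0%N then cos a else sin a)%:C.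

Lemma rotation_unitary (R : realType) (a : R) : rotation a \is unitarymx.
Proof.
have conjE (x : R) : Num.conj (x%:C : R[i]) = x%:C := conjc_real x.
apply/unitarymxP/matrixP => i j.
rewrite !mxE big_ord_recl big_ord1 !mxE !conjE -!rmorphM -rmorphD.
have sc1 := cos2Dsin2 a; rewrite !expr2 in sc1.
case: i => -[|[|//]] ? /=; case: j => -[|[|//]] ? /=; rewrite ?mulr1n ?mulr0n.
- by rewrite mulrNN sc1.
- by apply: (congr1 (real_complex R) (y := 0)); ring.
- by apply: (congr1 (real_complex R) (y := 0)); ring.
- by rewrite addrC sc1.
Qed.

Lemma rotation_angle_state (R : realType) (a b : R) :
  rotation b *m angle_state a = angle_state (a + b).
Proof.
apply/matrixP => i j; rewrite !mxE big_ord_recl big_ord1 !mxE -!rmorphM -rmorphD.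
case: i => -[|[|//]] ? /=; rewrite ?cosD ?sinD; congr (_%:C); ring.
Qed.

Lemma sqnorm_angle_state (R : realType) (a : R) : sqnorm (angle_state a) = 1.
Proof.
rewrite /sqnorm big_ord_recl big_ord1 !mxE /= !expr0n /= !addr0.
by rewrite !sqr_sqrtr ?sqr_ge0 ?cos2Dsin2.
Qed.

(** Since [cos (pi / 2) = 0], the addition formulas exchange the roles of sine and cosine at each
    quarter turn. The vanishing amplitude is what makes a measurement after [m] quarter turns
    deterministic. *)
Lemma cos_sin_quarter_turns (R : realType) (m : nat) :
  (if odd m then cos else sin) (pi / 2 *+ m) = 0 :> R.
Proof.
elim: m => [|m IH] /=; first by rewrite mulr0n sin0.
rewrite mulrS addrC; case: (odd m) IH => /= IH.
  by rewrite sinD IH mul0r cos_pihalf mulr0 addr0.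
by rewrite cosD IH mul0r cos_pihalf mulr0 subr0.
Qed.

Lemma qproj_quarter_turns (R : realType) (m : nat) (o : bool) :
  qproj ord0 o (angle_state (pi / 2 *+ m))
  = if o == odd m then angle_state (pi / 2 *+ m) else 0 :> qvec R 1.
Proof.
have z := cos_sin_quarter_turns R m.
apply/matrixP => i j; case: i => -[|[|//]] ?; rewrite mxE /qubit_value /=;
  case: o; case: (odd m) z => /= z; by rewrite ?mxE //= z.
Qed.

Lemma load_id (R : realType) (s : nat) (v : qvec R s) : load s v = v.
Proof. by apply/matrixP => i j; rewrite !mxE (valK i) (ord1 j). Qed.

Lemma sqnorm0 (R : realType) (s : nat) : sqnorm (0 : qvec R s) = 0.
Proof.
by rewrite /sqnorm big1 // => i _; rewrite mxE /= expr0n addr0 sqrtr0 expr0n.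
Qed.

Lemma qproj0 (R : realType) (s : nat) (j : 'I_s) (o : bool) :
  qproj j o (0 : qvec R s) = 0.
Proof. by apply/matrixP => i l; rewrite !mxE; case: ifP. Qed.

(** Generalizes [expected_cost] to any memory content and any payoff [f], so that an induction on
    the input can absorb the answers already given into [f]. *)
Definition run_sum {R : realType} {X Y : Type} {A : quantum_online R X Y}
    (c : (cbits A).-tuple bool) (v : qvec R (qubits A)) (I : seq X)
    (f : seq Y -> R) : R :=
  \sum_(e <- runs c v I) sqnorm e.2 * f e.1.

Lemma run_sum_cons (R : realType) (X Y : Type) (A : quantum_online R X Y)
    c v x I f :
  @run_sum R X Y A c v (x :: I) f =
  \sum_(br <- qexec (step x c) v)
    run_sum br.1.1 br.2 I (fun ys => f (br.1.2 :: ys)).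
Proof.
by rewrite /run_sum /= big_flatten big_map; apply: eq_bigr => br _; rewrite big_map.
Qed.

(** Unitaries and unnormalized projections are linear, so every branch stays at the zero vector.
    This serves to discard impossible measurement outcomes. *)
Lemma qexec_sum0 (R : realType) (s : nat) (T : Type) (q : qprog R s T)
    (F : T * qvec R s -> R) :
  (forall t, F (t, 0) = 0) -> \sum_(br <- qexec q 0) F br = 0.
Proof.
move=> F0; elim: q => [t|U uU q IH|j g IH] /=; first by rewrite big_seq1.
  by rewrite mulmx0.
by rewrite big_cat /= !qproj0 !IH addr0.
Qed.

Lemma run_sum0 (R : realType) (X Y : Type) (A : quantum_online R X Y) c I f :
  @run_sum R X Y A c 0 I f = 0.
Proof.
elim: I c f => [|x I IH] c f; first by rewrite /run_sum big_seq1 sqnorm0 mul0r.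
by rewrite run_sum_cons qexec_sum0.
Qed.

(** The request [x] itself multiplies the angle, so a request 0 rotates by 0. The answer [false]
    outside requests 2 is a filler that [hat_answers] drops. *)
Definition hats_algorithm (R : realType) (k : nat) : quantum_online R 'I_3 bool :=
  @QuantumOnline R 'I_3 bool 1 0 (fun x c =>
    if x == two then QMeasure ord0 (fun o => QRet _ _ (c, o))
    else QApply (rotation_unitary R (pi / 2 / (2 ^ k)%:R *+ x))
           (QRet _ _ (c, false))).

(** Classical trace of the algorithm: [m] counts the quarter turns of the qubit, including those
    encoded in the advice. *)
Fixpoint hats_outputs (k m : nat) (Xs : seq (seq bool)) : seq bool :=
  if Xs is X :: Xs' then
    odd m :: nseq (size X) false ++ hats_outputs k (m + ones X %/ 2 ^ k) Xs'
  else [::].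

Lemma bit_neq_two b : (bit b == two) = false.
Proof. by apply/eqP => /(congr1 val); rewrite /= !inordK //; case: b. Qed.

Lemma run_sum_bits (R : realType) (k : nat) c (a : R) (X : seq bool) I f :
  @run_sum R _ _ (hats_algorithm R k) c (angle_state a) (map bit X ++ I) f =
  @run_sum R _ _ (hats_algorithm R k) c
    (angle_state (a + pi / 2 / (2 ^ k)%:R *+ ones X)) I
    (fun ys => f (nseq (size X) false ++ ys)).
Proof.
elim: X a f => [|b X IH] a f /=; first by rewrite addr0.
rewrite run_sum_cons /= bit_neq_two /= big_seq1 /= rotation_angle_state IH.
rewrite -addrA -mulrnDr; do 4 congr (_ _); rewrite /ones /= inordK; by case: b.
Qed.

Lemma run_sum_blocks (R : realType) (k m : nat) c (Xs : seq (seq bool)) f :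
  all (fun X => (2 ^ k %| ones X)%N) Xs ->
  @run_sum R _ _ (hats_algorithm R k) c (angle_state (pi / 2 *+ m))
    (flatten [seq two :: map bit X | X <- Xs]) f = f (hats_outputs k m Xs).
Proof.
elim: Xs m f => [|X Xs IH] m f /=.
  by rewrite /run_sum big_seq1 sqnorm_angle_state mul1r.
case/andP => dX dXs; rewrite run_sum_cons /= eqxx /= big_cons big_seq1 /=.
rewrite !qproj_quarter_turns.
have block g : @run_sum R _ _ (hats_algorithm R k) c (angle_state (pi / 2 *+ m))
    (map bit X ++ flatten [seq two :: map bit X0 | X0 <- Xs]) g =
    g (nseq (size X) false ++ hats_outputs k (m + ones X %/ 2 ^ k) Xs).
  (* Divisibility by [2 ^ k] groups the small rotations of the block into whole quarter turns. *)
  rewrite run_sum_bits -[in X in angle_state (_ + _ *+ X)](divnK dX).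
  rewrite mulnC mulrnA -[_ / (2 ^ k)%:R *+ _]mulr_natr divfK.
    by rewrite -mulrnDr IH.
  by rewrite pnatr_eq0 expn_eq0.
(* The outcome other than [odd m] leaves the zero vector; [block] evaluates the other branch. *)
by case: (odd m) => /=; rewrite run_sum0 block ?add0r ?addr0.
Qed.

Lemma size_hats_outputs k m Xs :
  size (hats_outputs k m Xs) = size (flatten [seq two :: map bit X | X <- Xs]).
Proof.
elim: Xs m => [//|X Xs IH] m /=; by rewrite !size_cat size_nseq size_map IH.
Qed.

Lemma hat_answers_outputs k m X Xs :
  hat_answers (flatten [seq two :: map bit X | X <- X :: Xs])
    (hats_outputs k m (X :: Xs)) =
  odd m :: hat_answers (flatten [seq two :: map bit X | X <- Xs])
    (hats_outputs k (m + ones X %/ 2 ^ k) Xs).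
Proof.
rewrite /hat_answers /= eqxx map_cat mask_cat ?size_nseq ?size_map //.
congr (_ :: _); rewrite -[RHS]cat0s; congr (_ ++ _).
by elim: X => //= b X IH; rewrite bit_neq_two.
Qed.

(** Addition modulo 2 is its own inverse: adding the parity of block [j] to [z_j] cancels it and
    leaves [z_(j+1)], so a correct start makes all three answers correct. *)
Lemma hats_outputs_correct k (X : 3.-tuple (seq bool)) :
  hats_correct k (hats_input X) (hats_outputs k (hats_z k X ord0) X).
Proof.
exists X; split => //; rewrite /hats_input.
case/tupleP: X => X0 X; case/tupleP: X => X1 X; case/tupleP: X => X2 X.
rewrite (tuple0 X) -[tval _]/[:: X0; X1; X2] !hat_answers_outputs /=.
rewrite !enum_ordSl enum_ord0 /= /hats_z.
do 3 rewrite big_mkcond !big_ord_recl big_ord0 /=.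
rewrite /partialMOD /= !oddD !oddb /hat_answers /=.
by do 3 case: (odd _).
Qed.

Theorem theorem13 (R : realType) (n k : nat) (r w : R)
    (r_gt0 : 0 < r) (r_lt_w : r < w) :
  exists A : quantum_online R (request (hats n k r w)) (answer (hats n k r w)),
    [/\ pure A, qubits A = 1%N & optimal (P := hats n k r w) A 1].
Proof.
pose P := hats n k r w.
have cost_ge I ys : r <= @cost _ P I ys by rewrite /=; case: ifP => _ //; exact: ltW.
have good I : exists ys, @feasible _ P I -> size ys = size I /\ @cost _ P I ys = r.
  (* The lower bound [r] is attained by the outputs started from the true first parity; [[::]] is a
     default for infeasible inputs. *)
  have [[_ [X [-> _]]]|nfI] := pselect (@feasible _ P I); last by exists [::].
  exists (hats_outputs k (hats_z k X ord0) X) => _; split.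
    exact: size_hats_outputs.
  by rewrite /= asboolT //; exact: hats_outputs_correct.
have [Opt OptP] := choice good.
exists (hats_algorithm R k); split=> //; exists Opt; split=> [I fI|I fI].
  by have [sz ->] := OptP I fI; split=> // ys _; exact: cost_ge.
have [_ ->] := OptP I fI.
have [_ [X [-> dX]]] := fI.
(* The advice is at angle 0 or [pi / 2], hence the basis state of the first parity; it fills the
   whole memory, so [load] is the identity. *)
exists 1%N, (angle_state (pi / 2 *+ hats_z k X ord0)); split=> //.
  exact: sqnorm_angle_state.
rewrite mul1r addr0 load_id /expected_cost.
rewrite -[X in X <= _]/(run_sum _ _ _ (@cost _ P (hats_input X))) run_sum_blocks.
  by rewrite /= asboolT //; exact: hats_outputs_correct.
by apply/allP => Y /tnthP[i ->]; case: (dX i).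
Qed.
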